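(* Let $(f_a)_{a\in\mathcal V}$ be a Multi-GM over a finite multi-graph $\mathcal G=(\mathcal V,\mathcal E)$, with Gauge Function $$z(x)=\frac{\prod_{a\in\mathcal V}h_a(x_a)}{\prod_{\alpha\in\mathcal E}(1+x_{\alpha_d}x_{\bar\alpha_d})},$$ and let $\alpha^{(1)},\dots,\alpha^{(|\mathcal E|)}$ be an ordering of the edges. Set $x^{(0)}=x$, $\mathrm Z^{(0)}(x)=z(x)$, and for $m=1,\dots,|\mathcal E|$ let $x^{(m)}=x^{(m-1)}\setminus\{x_{\alpha_d^{(m)}},x_{\bar\alpha_d^{(m)}}\}$ and $$\mathrm Z^{(m)}(x^{(m)})=\left.\left(1+\partial_{x_{\alpha_d^{(m)}}}\partial_{x_{\bar\alpha_d^{(m)}}}\right)\left(\left(1+x_{\alpha_d^{(m)}}x_{\bar\alpha_d^{(m)}}\right)\mathrm Z^{(m-1)}(x^{(m-1)})\right)\right|_{x_{\alpha_d^{(m)}}=x_{\bar\alpha_d^{(m)}}=0}.$$ Then $x^{(|\mathcal E|)}=\emptyset$ and $\mathrm Z^{(|\mathcal E|)}=Z$, the partition function of the Multi-GM.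
   Context: $\mathcal G=(\mathcal V,\mathcal E)$ is a finite undirected multi-graph; multiple edges and self-edges are allowed. Each $\alpha\in\mathcal E$ has two directed versions, $\alpha_d$ and its reverse $\bar\alpha_d$; $\mathcal E_d$ is the set of all directed edges, and $u(\alpha_d)=u(\bar\alpha_d)=\alpha$. Each directed edge is attached to exactly one node: for an edge joining two distinct nodes one of its two directed versions is attached to each end node; for a self-edge both directed versions are attached to its node. $e_d(a)$ is the set of directed edges attached to node $a$, and $\Sigma_a=\{0,1\}^{e_d(a)}$. A Multi-GM is a collection of factors $f_a:\Sigma_a\to[0,\infty)$, $a\in\mathcal V$. For $\sigma\in\{0,1\}^{\mathcal E}$, $\sigma_a\in\Sigma_a$ is given by $(\sigma_a)_\gamma=\sigma_{u(\gamma)}$ for $\gamma\in e_d(a)$. The partition function is $Z=\sum_{\sigma\in\{0,1\}^{\mathcal E}}\prod_{a\in\mathcal V}f_a(\sigma_a)$. Variables: $x=(x_\gamma)_{\gamma\in\mathcal E_d}$, $x_a=(x_\gamma)_{\gamma\in e_d(a)}$, and $h_a(x_a)=\sum_{s\in\Sigma_a}f_a(s)\prod_{\gamma\in e_d(a)}x_\gamma^{s_\gamma}$. The functions $z$ and $\mathrm Z^{(m)}$ are rational functions of the variables. *)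

(* Defs.v *)
From HB Require Import structures.
From mathcomp Require Import all_boot all_order all_algebra.
From mathcomp Require Import boolp reals topology normedtype derive.

Set Implicit Arguments.
Unset Strict Implicit.
Unset Printing Implicit Defensive.

Import Order.TTheory GRing.Theory Num.Theory.
Import numFieldNormedType.Exports.

Local Open Scope ring_scope.

(** A finite undirected multi-graph.  The directed versions of an edge [al] are
    [(al, true)] and [(al, false)], and [att] sends each directed edge to the
    node it is attached to: [al] joins [att (al, true)] and [att (al, false)],
    and is a self-edge when these coincide. *)
Record multigraph := MultiGraph {
  vertex : finType;
  edge : finType;
  att : edge * bool -> vertex }.

Definition dedge (G : multigraph) : finType := (edge G * bool)%type.

Definition fwd (G : multigraph) (al : edge G) : dedge G := (al, true).
Definition bwd (G : multigraph) (al : edge G) : dedge G := (al, false).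

(** The map [u] from directed edges to edges. *)
Definition under (G : multigraph) (g : dedge G) : edge G := g.1.

Definition edges_at (G : multigraph) (a : vertex G) : finType :=
  {g : dedge G | att g == a}.

Definition local_config (G : multigraph) (a : vertex G) : finType :=
  {ffun edges_at a -> bool}.

Record multiGM (R : realType) (G : multigraph) := MultiGM {
  factor :> forall a : vertex G, local_config a -> R;
  factor_ge0 : forall (a : vertex G) (s : local_config a), 0 <= factor s }.

Section GaugeFunction.
Variables (R : realType) (G : multigraph) (f : multiGM R G).

Definition restrict_config (sigma : {ffun edge G -> bool}) (a : vertex G) :
    local_config a :=
  [ffun g : edges_at a => sigma (under (val g))].

Definition partition_function : R :=
  \sum_(sigma : {ffun edge G -> bool})
    \prod_(a : vertex G) f a (restrict_config sigma a).

Definition h (a : vertex G) (xa : edges_at a -> R) : R :=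
  \sum_(s : local_config a) f a s * \prod_(g : edges_at a) xa g ^+ s g.

(** As a function on points, with [y / 0 = 0] at the poles; every derivative
    taken below is at a zero of the two variables involved, where the
    corresponding denominator factor is 1. *)
Definition gauge (x : dedge G -> R) : R :=
  (\prod_(a : vertex G) h (fun g : edges_at a => x (val g))) /
  (\prod_(al : edge G) (1 + x (fwd al) * x (bwd al))).

Definition pderiv (g : dedge G) (F : (dedge G -> R) -> R)
    (x : dedge G -> R) : R :=
  derive1 (fun t : R => F [eta x with g |-> t]) (x g).

Definition eliminate (F : (dedge G -> R) -> R) (al : edge G)
    (x : dedge G -> R) : R :=
  let H y := (1 + y (fwd al) * y (bwd al)) * F y in
  let x0 := [eta x with fwd al |-> 0, bwd al |-> 0] in
  H x0 + pderiv (fwd al) (pderiv (bwd al) H) x0.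

(** With [s] listing the edges in the chosen order, [vars_after s m] is the
    index set of the variables in x^(m), and [Z_after s m] is Z^(m).  The
    latter is a function on all points that reads only the variables in x^(m)
    (lemma [Z_after_local]). *)
Definition vars_after (s : seq (edge G)) (m : nat) : {set dedge G} :=
  foldl (fun A al => A :\: [set fwd al; bwd al]) [set: dedge G] (take m s).

Definition Z_after (s : seq (edge G)) (m : nat) : (dedge G -> R) -> R :=
  foldl eliminate gauge (take m s).

Lemma Z_after_local (s : seq (edge G)) (m : nat) (x y : dedge G -> R) :
  {in vars_after s m, x =1 y} -> Z_after s m x = Z_after s m y.
Proof.
rewrite /vars_after /Z_after; elim/last_ind: (take m s) x y => [|t al IH] x y.
  by move=> xy; congr (_ / _); apply: eq_bigr => i _;
    [apply: eq_bigr => c _; congr (_ * _); apply: eq_bigr => g _|];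
    rewrite !xy ?inE.
rewrite !foldl_rcons; move: (foldl eliminate _ _) (foldl _ setT _) IH => F A IH xy.
pose B := A :|: [set fwd al; bwd al].
have pderivB g (K : (dedge G -> R) -> R) : g \in B ->
    (forall p q, {in B, p =1 q} -> K p = K q) ->
    forall p q, {in B, p =1 q} -> pderiv g K p = pderiv g K q.
  move=> gB KB p q pq; rewrite /pderiv pq //; apply: (congr1 (fun F => derive1 F (q g))).
  apply/funext => u; apply: KB => k kB /=.
  by case: ifP => // _; exact: pq.
rewrite /eliminate; set H := fun y : dedge G -> R => _ * F y.
have HB p q : {in B, p =1 q} -> H p = H q.
  move=> pq; rewrite /H !pq ?inE ?eqxx ?orbT //; congr (_ * _).
  by apply: IH => g gA; apply: pq; rewrite inE gA.
set p := (X in H X + _ = _); set q := (X in _ = H X + _).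
have pq : {in B, p =1 q}.
  move=> g; rewrite !inE /p /q /=.
  case: (eqVneq g (fwd al)) => // gf; case: (eqVneq g (bwd al)) => // gb.
  by rewrite !orbF => gA; apply: xy; rewrite !inE (negPf gf) (negPf gb).
rewrite (HB _ _ pq); apply: (congr1 (+%R (H q))).
apply: (pderivB) pq; first by rewrite !inE eqxx orbT.
by apply: pderivB => //; rewrite !inE eqxx !orbT.
Qed.

End GaugeFunction.

(* Main.v *)
(** Each directed edge is attached to a single node, so the numerator of the
    gauge function is affine in every variable separately.  As a function of the
    two variables [t], [u] of one edge it is [A + B t + C u + D t u]; multiplying
    by [1 + t u] cancels the denominator of this edge, and applying [1 + d_t d_u]
    at [t = u = 0] leaves [A + D].  Here [A] is the part where both directed
    versions of the edge carry 0, and [D] the part where both carry 1, so each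
    elimination replaces two variables by a sum over the common value of the
    edge.  After all eliminations this is the sum over all configurations. *)
Require Import Defs.
From HB Require Import structures.
From mathcomp Require Import all_boot all_order all_algebra.
From mathcomp Require Import boolp reals topology normedtype derive.
From mathcomp Require Import ring.

Set Implicit Arguments.
Unset Strict Implicit.
Unset Printing Implicit Defensive.

Import Order.TTheory GRing.Theory Num.Theory.
Import numFieldNormedType.Exports.

Local Open Scope ring_scope.

Lemma derive1_affine (R : realType) (a b z : R) :
  derive1 (fun u : R => a + b * u) z = b.
Proof.
rewrite derive1E.
have H : is_derive z 1 (fun u : R => a + b * u) (0 + b *: 1).
  by apply: is_deriveD.
by rewrite derive_val add0r [_ *: _]mulr1.
Qed.

Section Elimination.
Variables (R : realType) (G : multigraph).
Implicit Types (x : dedge G -> R) (al : edge G) (t u : R).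

Definition set_pair x al t u : dedge G -> R :=
  [eta x with fwd al |-> t, bwd al |-> u].

(* The hypothesis includes the poles [1 + t * u = 0] and [Q = 0], where
   it forces [F] to vanish; the derivative in the second variable needs only the
   neighborhood of [u = 0] where [1 + t * u] is nonzero. *)
Lemma eliminate_bilinear (F : (dedge G -> R) -> R) al x (A B C D Q : R) :
  (forall t u, F (set_pair x al t u) =
     (A + B * t + C * u + D * (t * u)) / ((1 + t * u) * Q)) ->
  eliminate F al x = (A + D) / Q.
Proof.
move=> HF; rewrite /eliminate.
set H := fun y : dedge G -> R => _ * F y.
have HE t u : 1 + t * u != 0 ->
    H (set_pair x al t u) = (A + B * t) / Q + (C + D * t) / Q * u.
  move=> nz; rewrite /H HF /set_pair /= eqxx /fwd /bwd xpair_eqE andbF eqxx.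
  by rewrite invfM mulrCA !mulrA mulfK //; ring.
rewrite -[LHS]/(H (set_pair x al 0 0) +
  pderiv (fwd al) (pderiv (bwd al) H) (set_pair x al 0 0)).
rewrite HE ?mul0r ?addr0 ?oner_neq0 //.
have inner t : pderiv (bwd al) H (set_pair x al t 0) = (C + D * t) / Q.
  rewrite /pderiv.
  have -> : set_pair x al t 0 (bwd al) = 0.
    by rewrite /set_pair /= /fwd /bwd xpair_eqE andbF eqxx.
  rewrite -(derive1_affine ((A + B * t) / Q) ((C + D * t) / Q) 0) !derive1E.
  apply: near_eq_derive.
  have cont : {for 0, continuous (fun u : R => 1 + t * u)}.
    apply: cvgD; first exact: cvg_cst.
    by apply: cvgM; [exact: cvg_cst | exact: cvg_id].
  have nz0 : 1 + t * 0 != 0 :> R by rewrite mulr0 addr0 oner_neq0.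
  apply: filterS (cvgr_neq0 _ cont nz0) => u nz.
  rewrite -HE //; congr H; apply/funext => g; rewrite /set_pair /=.
  case: (eqVneq g (bwd al)) => [->|//].
  by rewrite /fwd /bwd xpair_eqE andbF.
(* [inner] holds for every [t], so the outer derivative is that of a globally affine function and
   needs no neighborhood. *)
have -> : pderiv (fwd al) (pderiv (bwd al) H) (set_pair x al 0 0) = D / Q.
  rewrite -[RHS](derive1_affine (C / Q) (D / Q) (set_pair x al 0 0 (fwd al))).
  apply: (congr1 (fun F => derive1 F _)); apply/funext => t.
  rewrite -[LHS]/(pderiv (bwd al) H [eta set_pair x al 0 0 with fwd al |-> t]).
  have E : ([eta set_pair x al 0 0 with fwd al |-> t] : dedge G -> R) =
      set_pair x al t 0.
    by apply/funext => g; rewrite /set_pair /=; case: (g == fwd al).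
  by rewrite E inner; ring.
by rewrite !mulr0 !addr0 mulrDl.
Qed.

End Elimination.

Section Weights.
Variables (R : realType) (G : multigraph) (f : multiGM R G).
Implicit Types (w : dedge G -> bool -> R) (x : dedge G -> R).

Definition local_weight w (a : vertex G) : R :=
  \sum_(s : local_config a) f a s * \prod_(g : edges_at a) w (val g) (s g).

(* The numerator of the gauge function, made linear: the pair [w g] stands for
   the values of [x_g ^ 0] and [x_g ^ 1], and for an eliminated edge it is the
   indicator of the bit chosen there. *)
Definition weight w : R := \prod_(a : vertex G) local_weight w a.

Lemma eq_weight w1 w2 : (forall g b, w1 g b = w2 g b) -> weight w1 = weight w2.
Proof.
by move=> ww; apply: eq_bigr => a _; apply: eq_bigr => s _; congr (_ * _);
  apply: eq_bigr.
Qed.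

(** Only the factor at [att g] reads [w g], and each product in its local sum contains exactly one
    value of [w g]. *)
Lemma weight_linear (g : dedge G) (w w1 w2 : dedge G -> bool -> R) (c : R) :
  (forall b, w g b = w1 g b + c * w2 g b) ->
  (forall k b, k != g -> w1 k b = w k b) ->
  (forall k b, k != g -> w2 k b = w k b) ->
  weight w = weight w1 + c * weight w2.
Proof.
move=> wg w1E w2E.
have split w' : weight w' = local_weight w' (att g) *
    \prod_(a | a != att g) local_weight w' a by rewrite /weight (bigD1 (att g)).
have other w' : (forall k b, k != g -> w' k b = w k b) ->
    \prod_(a | a != att g) local_weight w' a =
    \prod_(a | a != att g) local_weight w a.
  move=> w'E; apply: eq_bigr => a ag; apply: eq_bigr => s _; congr (_ * _).
  apply: eq_bigr => k _; apply: w'E.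
  by apply: contraNneq ag => <-; rewrite eq_sym (valP k).
rewrite !split (other w1) // (other w2) // mulrA -mulrDl; congr (_ * _).
rewrite /local_weight mulr_sumr -big_split; apply: eq_bigr => s _ /=.
pose g0 : edges_at (att g) := exist _ g (eqxx _).
have split0 (w' : dedge G -> bool -> R) : \prod_k w' (val k) (s k) =
    w' g (s g0) * \prod_(k | k != g0) w' (val k) (s k) by rewrite (bigD1 g0).
have rest w' : (forall k b, k != g -> w' k b = w k b) ->
    \prod_(k | k != g0) w' (val k) (s k) = \prod_(k | k != g0) w (val k) (s k).
  by move=> w'E; apply: eq_bigr => k kg; apply: w'E; rewrite -(inj_eq val_inj) in kg.
by rewrite !split0 (rest w1) // (rest w2) // wg; ring.
Qed.

Definition mixed_weight (t : seq (edge G)) (sigma : {ffun edge G -> bool}) x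
    (g : dedge G) (b : bool) : R :=
  if under g \in t then (b == sigma (under g))%:R else x g ^+ b.

Definition set_config (sigma : {ffun edge G -> bool}) (al : edge G) b :
    {ffun edge G -> bool} :=
  [ffun k => if k == al then b else sigma k].

(** Each directed version of [al] is expanded on its own by
    [y ^+ b = (b == false) + y * (b == true)], so self-edges need no separate case. [B] and [C] stay
    anonymous because elimination discards them. *)
Lemma mixed_weight_bilinear t al sigma x : al \notin t ->
  exists B C, forall y z : R,
    weight (mixed_weight t sigma (set_pair x al y z)) =
    weight (mixed_weight (rcons t al) (set_config sigma al false) x) +
      B * y + C * z +
    weight (mixed_weight (rcons t al) (set_config sigma al true) x) * (y * z).
Proof.
move=> alt.
pose w (p q : bool -> R) (g : dedge G) (b : bool) :=
  if g == fwd al then p b else if g == bwd al then q b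
  else mixed_weight t sigma x g b.
pose e (c b : bool) : R := (b == c)%:R.
pose pw (y : R) (b : bool) := y ^+ b.
have fb : (bwd al == fwd al) = false by rewrite /fwd /bwd xpair_eqE andbF.
have wf q y : weight (w (pw y) q) =
    weight (w (e false) q) + y * weight (w (e true) q).
  apply: (@weight_linear (fwd al)) => [b|k b /negPf kf|k b /negPf kf];
    rewrite /w ?kf ?eqxx //.
  by case: b; rewrite /pw /e /= ?expr0 ?expr1; ring.
have wb p z : weight (w p (pw z)) =
    weight (w p (e false)) + z * weight (w p (e true)).
  apply: (@weight_linear (bwd al)) => [b|k b /negPf kf|k b /negPf kf];
    rewrite /w ?kf ?fb ?eqxx //.
  by case: b; rewrite /pw /e /= ?expr0 ?expr1; ring.
have diag c : weight (mixed_weight (rcons t al) (set_config sigma al c) x) =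
    weight (w (e c) (e c)).
  apply: eq_weight => -[k d] b; rewrite /w /mixed_weight /e /fwd /bwd /= !xpair_eqE.
  rewrite mem_rcons inE ffunE; case: (eqVneq k al) => [->|//] /=.
  by case: d.
(* The cross terms are those where the two directed versions of [al] carry different bits. *)
exists (weight (w (e true) (e false))), (weight (w (e false) (e true))) => y z.
rewrite !diag.
have -> : weight (mixed_weight t sigma (set_pair x al y z)) =
    weight (w (pw y) (pw z)).
  apply: eq_weight => -[k d] b.
  rewrite /w /mixed_weight /set_pair /fwd /bwd /pw /= !xpair_eqE.
  by case: (eqVneq k al) => [->|//]; rewrite (negPf alt) /=; case: d.
by rewrite wf !wb; ring.
Qed.

(** Extension by [false] outside [t] gives each bit assignment on [t] a unique representative in a
    type independent of [t]. *)
Definition supported (t : seq (edge G)) (sigma : {ffun edge G -> bool}) :=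
  [forall k, sigma k ==> (k \in t)].

Lemma sum_supported_rcons t al (F : {ffun edge G -> bool} -> R) : al \notin t ->
  \sum_(sigma | supported (rcons t al) sigma) F sigma =
  \sum_(sigma | supported t sigma)
    (F (set_config sigma al false) + F (set_config sigma al true)).
Proof.
move=> alt; rewrite big_split /= (bigID (fun sigma : {ffun edge G -> bool} => ~~ sigma al)) /=.
have supp b sigma : supported (rcons t al) (set_config sigma al b) &&
    (set_config (set_config sigma al b) al false == sigma) = supported t sigma.
  apply/andP/forallP => [[/forallP s1 /eqP s2] k|s1].
    apply/implyP => sk; have := s1 k; rewrite ffunE mem_rcons inE.
    by rewrite -s2 !ffunE in sk; move: sk; case: (eqVneq k al) => // _ ->.
  split.
    apply/forallP => k; rewrite ffunE mem_rcons inE.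
    by case: (eqVneq k al) => _; [rewrite implybT | exact: s1].
  apply/eqP/ffunP => k; rewrite !ffunE; case: eqVneq => [->|//].
  by apply/esym/negbTE/negP => sal; move: (s1 al); rewrite sal (negPf alt).
have E b : \sum_(sigma | supported (rcons t al) sigma && (sigma al == b)) F sigma
    = \sum_(sigma | supported t sigma) F (set_config sigma al b).
  (* Resetting [al] to [false] inverts setting it to [b], since supported configurations vanish at
     [al], which is not in [t]. *)
  rewrite (reindex_onto (fun sigma => set_config sigma al b)
    (fun sigma => set_config sigma al false)) /=.
    apply: eq_bigl => sigma.
    have -> : set_config sigma al b al = b by rewrite ffunE eqxx.
    by rewrite eqxx andbT supp.
  move=> sigma /andP[_ /eqP sb]; apply/ffunP => k; rewrite !ffunE.
  by case: eqVneq => [->|].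
rewrite -!E; congr (_ + _); apply: eq_bigl => sigma; congr (_ && _);
  by case: (sigma al).
Qed.

(** The invariant of the induction on eliminated edges. It holds at every point, poles included, as
    [eliminate_bilinear] requires. *)
Lemma foldl_eliminate t x : uniq t ->
  foldl (@eliminate R G) (gauge f) t x =
  (\sum_(sigma | supported t sigma) weight (mixed_weight t sigma x)) /
  \prod_(al | al \notin t) (1 + x (fwd al) * x (bwd al)).
Proof.
elim/last_ind: t x => [|t al IH] x.
  move=> _; rewrite /= /gauge; congr (_ / _).
  rewrite (big_pred1 [ffun=> false]) // => sigma; rewrite /supported /=.
  apply/forallP/eqP => [s0|-> k]; last by rewrite ffunE.
  by apply/ffunP => k; rewrite ffunE; case: (sigma k) (s0 k).
rewrite rcons_uniq => /andP[alt tu]; rewrite foldl_rcons sum_supported_rcons //.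
(* The cross coefficients depend on [sigma]; choosing them as functions allows summing them over
   configurations. *)
have /choice[B HB] sigma := mixed_weight_bilinear sigma x alt.
have /choice[C HC] := HB.
rewrite big_split; apply: eliminate_bilinear (\sum_(sigma | supported t sigma) B sigma)
  (\sum_(sigma | supported t sigma) C sigma) _ _ _ => y z.
rewrite IH // (eq_bigr _ (fun sigma _ => HC sigma y z)) !big_split -!mulr_suml /=.
congr (_ / _); rewrite (bigD1 al) //= /set_pair /fwd /bwd /= !xpair_eqE !eqxx !andbF /=.
congr (_ * _); rewrite [RHS](eq_bigl (fun k => (k \notin t) && (k != al))); last first.
  by move=> k; rewrite mem_rcons inE negb_or andbC.
apply: eq_bigr => k /andP[_ /negPf kal].
by rewrite !xpair_eqE kal.
Qed.

(** With every edge eliminated all weights are indicators, so each local sum keeps a single term. *)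
Lemma weight_config sigma (t : seq (edge G)) x : (forall al, al \in t) ->
  weight (mixed_weight t sigma x) = \prod_a f a (restrict_config sigma a).
Proof.
move=> tT; apply: eq_bigr => a _; rewrite /local_weight.
rewrite (bigD1 (restrict_config sigma a)) //= [X in _ + X]big1 ?addr0.
  by rewrite big1 ?mulr1 // => g _; rewrite /mixed_weight tT ffunE eqxx.
move=> s sn; have [g gn] : exists g, s g != sigma (under (val g)).
  apply/existsP; apply: contraNT sn; rewrite negb_exists => /forallP sE.
  by apply/eqP/ffunP => g; rewrite ffunE; apply/eqP; rewrite -[_ == _]negbK sE.
by rewrite (bigD1 g) //= /mixed_weight tT (negPf gn) mul0r mulr0.
Qed.

End Weights.

Theorem theoremV1 (R : realType) (G : multigraph) (f : multiGM R G)
    (s : #|edge G|.-tuple (edge G)) (s_uniq : uniq s) :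
  vars_after s #|edge G| = set0 /\
  (forall x : dedge G -> R, Z_after f s #|edge G| x = partition_function f).
Proof.
have sT al : al \in s.
  have /subset_cardP/(_ (subset_predT _)) -> // : #|s| = #|edge G|.
  by rewrite (card_uniqP s_uniq) size_tuple.
have sE : take #|edge G| s = s by rewrite take_oversize // size_tuple.
split=> [|x]; last first.
  rewrite /Z_after sE foldl_eliminate // [X in _ / X]big1 ?divr1; last first.
    by move=> al; rewrite sT.
  rewrite /partition_function; apply: eq_big => [sigma|sigma _].
    by apply/forallP => al; rewrite sT implybT.
  exact: weight_config.
rewrite /vars_after sE.
(* The starting set is generalized because [foldl] changes it at each step. *)
have notin (t : seq (edge G)) A g :
    (g \in foldl (fun A al => A :\: [set fwd al; bwd al]) A t) =
    (g \in A) && (under g \notin t).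
  elim: t A => [|al t IH] A /=; first by rewrite andbT.
  rewrite IH inE -andbA andbCA in_cons negb_or; congr (_ && (_ && _)).
  by case: g {IH} => k []; rewrite !inE /fwd /bwd !xpair_eqE !(andbT, andbF, orbF).
by apply/setP => g; rewrite notin !inE sT.
Qed.
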